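(* Let $M$ be a smooth manifold, let $E\to M$ be an orientable real vector bundle of rank $k$ equipped with a Riemannian structure, and let $n\ge k$. Then $E\to M$ admits a Parseval frame of size $n$ (i.e., a section of $\mathcal{P}^n(E)$) if and only if it admits a frame of size $n$ (i.e., a section of $\mathcal{F}^n(E)$).
   Context: A Riemannian structure on a real vector bundle $E\to M$ is a choice of inner product on each fiber $E_p$, varying smoothly in $p\in M$. For a $k$-dimensional real vector space $V$ and $n\ge k$, $\mathcal{F}^n(V)$ is the space of surjective linear maps $\mathbb{R}^n\to V$ (equivalently, spanning sequences of $n$ vectors in $V$). If $V$ has an inner product, $\mathcal{P}^n(V)\subset\mathcal{F}^n(V)$ is the subspace of $A$ with $AA^T=I_V$, where $A^T$ is the adjoint with respect to the standard inner product on $\mathbb{R}^n$ and the inner product on $V$ (equivalently, sequences $(f_j)_{j=1}^n$ with $\sum_j|\langle v,f_j\rangle|^2=\|v\|^2$ for all $v\in V$). $\mathcal{F}^n(E)\to M$ and $\mathcal{P}^n(E)\to M$ are the fiber subbundles of $\operatorname{Hom}(M\times\mathbb{R}^n,E)$ with fibers $\mathcal{F}^n(E_p)$ and $\mathcal{P}^n(E_p)$ over $p\in M$. Sections are understood to be smooth. *)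

(* Defs.v *)
From HB Require Import structures.
From mathcomp Require Import all_boot all_order all_algebra.
From mathcomp Require Import all_classical all_reals all_analysis.

Set Implicit Arguments.
Unset Strict Implicit.
Unset Printing Implicit Defensive.

Import Order.TTheory GRing.Theory Num.Theory.
Import numFieldNormedType.Exports.

Local Open Scope classical_set_scope.
Local Open Scope ring_scope.

(* [Ck_on r U f]: f is C^r on the open set U of R^d, i.e. all its iterated
   partial derivatives of order at most r exist and are continuous on U. *)
Fixpoint Ck_on (R : realType) (d r : nat) (U : set 'rV[R]_d)
    (f : 'rV[R]_d -> R) : Prop :=
  (forall x, U x -> {for x, continuous f}) /\
  (if r is s.+1 then
     forall i : 'I_d, (forall x, U x -> derivable f x (delta_mx 0 i)) /\
                      Ck_on s U ('D_(delta_mx 0 i) f)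
   else True).

Definition Cinfty_on (R : realType) (d : nat) (U : set 'rV[R]_d)
    (f : 'rV[R]_d -> R) : Prop := forall r, Ck_on r U f.

(* A smooth manifold (without boundary) of dimension d, given by a smooth
   atlas. The atlas need not be maximal: smoothness of a function is the same
   for an atlas and for the maximal atlas containing it. The coordinate map of
   the chart i is [coord_map i], meaningful on [chart_dom i] only, and
   [chart_inv i] inverts it, meaningfully on the image of [chart_dom i] only. *)
Record smooth_manifold (R : realType) (d : nat) := SmoothManifold {
  manifold_carrier :> topologicalType;
  manifold_hausdorff : hausdorff_space manifold_carrier;
  manifold_second_countable : @second_countable manifold_carrier;
  chart_index : Type;
  chart_dom : chart_index -> set manifold_carrier;
  coord_map : chart_index -> manifold_carrier -> 'rV[R]_d;
  chart_inv : chart_index -> 'rV[R]_d -> manifold_carrier;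
  chart_dom_open : forall i, open (chart_dom i);
  chart_cover : forall p, exists i, chart_dom i p;
  chart_image_open : forall i, open (coord_map i @` chart_dom i);
  coord_mapK : forall i p, chart_dom i p -> chart_inv i (coord_map i p) = p;
  coord_map_continuous : forall i,
    {within chart_dom i, continuous (coord_map i)};
  chart_inv_continuous : forall i,
    {within coord_map i @` chart_dom i, continuous (chart_inv i)};
  chart_transition_smooth : forall i j (a : 'I_d),
    Cinfty_on (coord_map i @` (chart_dom i `&` chart_dom j))
              (fun x => coord_map j (chart_inv i x) 0 a)
}.

(* Smoothness of a real function on an open subset U of M. *)
Definition smooth_on (R : realType) (d : nat) (M : smooth_manifold R d)
    (U : set M) (f : M -> R) : Prop :=
  forall i : chart_index M,
    Cinfty_on (coord_map i @` (chart_dom i `&` U))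
              (fun x => f (chart_inv i x)).

(* A smooth real vector bundle of rank k over M, given by its fibers and a
   cover of M by local trivializations, [triv i p] being the restriction to the
   fiber at p of the i-th one (meaningful for p in [triv_dom i] only), with
   smooth transition functions. The topology and the smooth structure of the
   total space are the unique ones making these trivializations
   diffeomorphisms. *)
Record vector_bundle (R : realType) (d : nat) (M : smooth_manifold R d)
    (k : nat) := VectorBundle {
  fiber :> M -> vectType R;
  triv_index : Type;
  triv_dom : triv_index -> set M;
  triv : triv_index -> forall p, 'Hom(fiber p, 'rV[R]_k);
  triv_dom_open : forall i, open (triv_dom i);
  triv_cover : forall p, exists i, triv_dom i p;
  triv_injective : forall i p, triv_dom i p -> lker (triv i p) = 0%VS;
  triv_surjective : forall i p, triv_dom i p -> limg (triv i p) = fullv;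
  triv_transition_smooth : forall i j (a b : 'I_k),
    smooth_on (triv_dom i `&` triv_dom j)
              (fun p => triv j p ((triv i p)^-1%VF (delta_mx 0 a)) 0 b)
}.

(* Smoothness, on an open subset U of M, of a section of E. *)
Definition smooth_section_on (R : realType) (d : nat)
    (M : smooth_manifold R d) (k : nat) (E : vector_bundle M k)
    (U : set M) (s : forall p, E p) : Prop :=
  forall (i : triv_index E) (a : 'I_k),
    smooth_on (U `&` triv_dom i) (fun p => triv i p (s p) 0 a).

Record riemannian_structure (R : realType) (d : nat)
    (M : smooth_manifold R d) (k : nat) (E : vector_bundle M k) :=
  RiemannianStructure {
  inner :> forall p, {dot (E p) for idfun};
  inner_smooth : forall (i : triv_index E) (a b : 'I_k),
    smooth_on (triv_dom i)
      (fun p => inner p ((triv i p)^-1%VF (delta_mx 0 a))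
                        ((triv i p)^-1%VF (delta_mx 0 b)))
}.

(* An orientation of V: an equivalence class of ordered bases of V, two bases
   being equivalent when the change of basis has positive determinant. *)
Definition is_orientation (R : realType) (V : vectType R) (k : nat)
    (O : set (k.-tuple V)) : Prop :=
  exists2 X : k.-tuple V, basis_of fullv X &
    O = [set Y : k.-tuple V | basis_of fullv Y /\
           0 < \det (\matrix_(i < k, j < k) coord X j (tnth Y i))].

(* E is orientable: its fibers can be given orientations that are, locally on
   M, represented by a smooth frame. *)
Definition orientable (R : realType) (d : nat) (M : smooth_manifold R d)
    (k : nat) (E : vector_bundle M k) : Prop :=
  exists O : forall p, set (k.-tuple (E p)),
    (forall p, is_orientation (O p)) /\
    (forall p, exists U : set M, [/\ open U, U p &
       exists e : forall q, k.-tuple (E q),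
         (forall q, U q -> O q (e q)) /\
         (forall a : 'I_k, smooth_section_on U (fun q => tnth (e q) a))]).

Section FiberFrames.
Variables (R : realType) (V : vectType R).

Definition frames (n : nat) : set 'Hom('rV[R]_n, V) :=
  [set A | limg A = fullv].

Variable g : {dot V for idfun}.

(* The adjoint of A for g and the standard inner product of R^n, see
   [adjointP]; its j-th coordinate at v is g (A e_j) v. *)
Definition adjoint (n : nat) (A : 'Hom('rV[R]_n, V)) : 'Hom(V, 'rV[R]_n) :=
  linfun (fun v => \row_(j < n) g (A (delta_mx 0 j)) v).

Lemma adjointE (n : nat) (A : 'Hom('rV[R]_n, V)) (v : V) :
  adjoint A v = \row_(j < n) g (A (delta_mx 0 j)) v.
Proof.
pose f (w : V) : 'rV[R]_n := \row_(j < n) g (A (delta_mx 0 j)) w.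
have f_lin : linear f.
  by move=> c u w; apply/rowP => j; rewrite !mxE linearP.
pose Lf : {linear V -> 'rV[R]_n} :=
  HB.pack f (GRing.isLinear.Build R V 'rV[R]_n *:%R f f_lin).
exact: (lfunE Lf).
Qed.

Lemma adjointP (n : nat) (A : 'Hom('rV[R]_n, V)) (x : 'rV[R]_n) (v : V) :
  \sum_(j < n) x 0 j * adjoint A v 0 j = g (A x) v.
Proof.
rewrite [in RHS](row_sum_delta x) linear_sum linear_sumlz /=.
apply: eq_bigr => j _.
by rewrite adjointE mxE linearZ /= linearZl_LR.
Qed.

Definition parseval_frames (n : nat) : set 'Hom('rV[R]_n, V) :=
  [set A | frames A /\ (A \o adjoint A)%VF = \1%VF].

End FiberFrames.

(* Smoothness of a section A of Hom(M x R^n, E): the matrix of A p in the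
   standard basis of R^n and the trivializations of E depends smoothly on p. *)
Definition smooth_hom_section (R : realType) (d : nat)
    (M : smooth_manifold R d) (k : nat) (E : vector_bundle M k) (n : nat)
    (A : forall p, 'Hom('rV[R]_n, E p)) : Prop :=
  forall j : 'I_n, smooth_section_on setT (fun p => A p (delta_mx 0 j)).

Definition admits_frame (R : realType) (d : nat)
    (M : smooth_manifold R d) (k : nat) (E : vector_bundle M k) (n : nat) :
    Prop :=
  exists A : forall p, 'Hom('rV[R]_n, E p),
    smooth_hom_section A /\ forall p, frames (A p).

Definition admits_parseval_frame (R : realType) (d : nat)
    (M : smooth_manifold R d) (k : nat) (E : vector_bundle M k)
    (g : riemannian_structure E) (n : nat) : Prop :=
  exists A : forall p, 'Hom('rV[R]_n, E p),
    smooth_hom_section A /\ forall p, parseval_frames (g p) (A p).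

(* Main.v *)
(* Let S = A A^T be the frame operator of a frame A. Then S^(-1/2) A is a
   Parseval frame; only its smoothness is at stake. In a local trivialization
   with Gram matrix G and the frame vectors as the rows of F, it becomes
   F H (H F^T F H)^(-1/2) H^(-1) with H = G^(1/2).
   The square root X of a smooth positive definite S is smooth because
   X(y) D + D X(x) = S(y) - S(x) for D = X(y) - X(x): coercivity of this
   Sylvester equation gives the continuity and the differentiability of X, and
   its partial derivatives solve X Z + Z X = dS, so that Cramer's rule
   bootstraps the regularity of X. *)
Require Import Defs.
From mathcomp Require Import all_boot all_order all_algebra.
From mathcomp Require Import all_classical all_reals all_analysis.
From mathcomp Require Import complex ring.

Set Implicit Arguments.
Unset Strict Implicit.
Unset Printing Implicit Defensive.

Import Order.TTheory GRing.Theory Num.Theory.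
Import numFieldNormedType.Exports.

Local Open Scope classical_set_scope.
Local Open Scope ring_scope.

(** * Positive definite matrices and their square roots *)

(** Newton interpolation: a new node [a] is handled by adding a multiple of a polynomial that
    vanishes on the earlier nodes and not at [a]. *)
Lemma poly_interpolation (F : fieldType) (s : seq F) (h : F -> F) :
  exists q : {poly F}, forall t, t \in s -> q.[t] = h t.
Proof.
elim: s => [|a s [q qP]]; first by exists 0.
have [as_|aNs] := boolP (a \in s).
  by exists q => t; rewrite inE => /predU1P[->|]; exact: qP.
pose p := \prod_(u <- s) ('X - u%:P).
have pa : p.[a] != 0.
  by rewrite -[_ == _]/(root p a) root_prod_XsubC.
exists (q + ((h a - q.[a]) / p.[a]) *: p) => t; rewrite !hornerE inE.
case/predU1P => [->|ts]; first by rewrite divfK // addrC subrK.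
have /eqP -> : root p t by rewrite root_prod_XsubC.
by rewrite mulr0 addr0 qP.
Qed.

Lemma mulmx1_invmx (F : fieldType) n (A B : 'M[F]_n) :
  A *m B = 1%:M -> invmx A = B.
Proof.
by move=> AB; have [Aunit _] := mulmx1_unit AB; rewrite -[LHS]mulmx1 -AB mulKmx.
Qed.

Section PositiveDefinite.
Variable R : rcfType.

Definition posdef n (S : 'M[R]_n) : Prop :=
  S^T = S /\ forall v : 'rV_n, v != 0 -> 0 < (v *m S *m v^T) 0 0.

Lemma dot_rV n (v : 'rV[R]_n) : (v *m v^T) 0 0 = \sum_i v 0 i ^+ 2.
Proof. by rewrite mxE; apply: eq_bigr => i _; rewrite mxE expr2. Qed.

Lemma dot_rV_ge0 n (v : 'rV[R]_n) : 0 <= (v *m v^T) 0 0.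
Proof. by rewrite dot_rV sumr_ge0 // => i _; exact: sqr_ge0. Qed.

Lemma dot_rV_gt0 n (v : 'rV[R]_n) : v != 0 -> 0 < (v *m v^T) 0 0.
Proof.
move=> v0; rewrite lt_def dot_rV_ge0 andbT dot_rV.
apply: contra_neq v0 => /eqP; rewrite psumr_eq0 => [|i _]; last exact: sqr_ge0.
move=> /allP v0; apply/rowP => i; rewrite mxE; apply/eqP.
by have /= := v0 i; rewrite mem_index_enum sqrf_eq0 => /(_ isT)/eqP ->.
Qed.

Lemma posdef_ge0 n (S : 'M[R]_n) (v : 'rV_n) :
  posdef S -> 0 <= (v *m S *m v^T) 0 0.
Proof.
move=> [_ Spos]; have [->|/Spos/ltW//] := eqVneq v 0.
by rewrite !mul0mx mxE.
Qed.

Lemma posdef_unit n (S : 'M[R]_n) : posdef S -> S \in unitmx.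
Proof.
move=> [_ Spos]; rewrite unitmxE unitfE; apply/det0P => -[v v0 vS].
by have := Spos _ v0; rewrite vS mul0mx mxE ltxx.
Qed.

Lemma posdef_mxsquare m n (A : 'M[R]_(m, n)) : row_free A -> posdef (A *m A^T).
Proof.
move=> Afree; split; first by rewrite trmx_mul trmxK.
move=> v v0; rewrite mulmxA -mulmxA -trmx_mul; apply: dot_rV_gt0.
by rewrite mulmx_free_eq0.
Qed.

Lemma posdef_eigen_gt0 n (S : 'M[R]_n) (t : R) :
  posdef S -> eigenvalue S t -> 0 < t.
Proof.
move=> [_ Spos] /eigenvalueP[v vS v0]; have := Spos _ v0.
by rewrite vS -scalemxAl mxE pmulr_lgt0 // dot_rV_gt0.
Qed.

(* Interpolating the fourth root on the spectrum gives a root with real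
   entries although the diagonalization takes place over [R[i]]. *)
Lemma posdef_root4 n (S : 'M[R]_n) :
  posdef S -> exists Y, Y^T = Y /\ Y *m Y *m Y *m Y = S.
Proof.
case: n S => [|n] S Spd.
  by exists 0; split; rewrite ?trmx0 // [RHS]flatmx0 [LHS]flatmx0.
have [Ssym _] := Spd.
pose f := real_complex R.
pose A : 'M[R[i]]_n.+1 := map_mx f S.
have Areal : A \is a realmx.
  apply/mxOverP => i j; rewrite mxE /f complex_real //.
have Aherm : A \is hermsymmx.
  apply: realsym_hermsym => //.
  apply/is_hermitianmxP; rewrite expr0 scale1r map_mx_id //.
  by rewrite /A map_trmx Ssym.
have /hermitian_normalmx/orthomx_spectralP := Aherm.
have := hermitian_spectral_diag_real Aherm; have := spectral_unit A.
move: (spectralmx A) (spectral_diag A) => P D Punit /mxOverP Dreal AE.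
pose t i : R := complex.Re (D 0 i).
have DE i : D 0 i = f (t i) by rewrite /f RRe_real.
(* The characteristic polynomial of [S] has coefficients in [R], so the eigenvalue [t i] of [A],
   with eigenvector [row i P] over [R[i]], is already an eigenvalue of [S] over [R]. *)
have tpos i : 0 < t i.
  apply: (posdef_eigen_gt0 Spd).
  rewrite eigenvalue_root_char -(fmorph_root f) map_char_poly -/A.
  rewrite -eigenvalue_root_char; apply/eigenvalueP; exists (row i P).
    have PA : P *m A = diag_mx D *m P by rewrite {1}AE !mulmxA mulmxV // mul1mx.
    by rewrite -row_mul PA row_mul row_diag_mx -scalemxAl -rowE DE.
  rewrite rowE mulmx_free_eq0 ?row_free_unit //.
  by apply/eqP => /rowP/(_ i)/eqP; rewrite !mxE !eqxx oner_eq0.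
have [q qP] := poly_interpolation [seq t i | i : 'I_n.+1]
  (fun u => Num.sqrt (Num.sqrt u)).
pose r := q * q * q * q - 'X.
have rt i : r.[t i] = 0.
  rewrite !hornerE qP; last by apply/mapP; exists i; rewrite ?mem_enum.
  set s := Num.sqrt _; have -> : s * s * s * s = (s ^+ 2) ^+ 2 by ring.
  by rewrite !sqr_sqrtr ?sqrtr_ge0 ?subrr ?ltW.
(* [r] vanishes on the spectrum, so it annihilates the diagonal form of [A]; injectivity of [map_mx]
   brings the identity back to [R]. *)
have rS : horner_mx S r = 0.
  apply: (@map_mx_inj _ _ f); rewrite map_horner_mx -/A map_mx0 AE.
  rewrite horner_mx_uconjC // horner_mx_diag.
  suff -> : map_mx (horner (map_poly f r)) D = 0.
    by rewrite linear0 mulmx0 mul0mx.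
  by apply/rowP => i; rewrite !mxE DE horner_map rt rmorph0.
exists (horner_mx S q); split.
  (* A polynomial in a symmetric matrix is symmetric. *)
  elim/poly_ind: q {qP r rt rS} => [|q c IH]; first by rewrite rmorph0 trmx0.
  rewrite rmorphD rmorphM /= horner_mx_X horner_mx_C linearD /= tr_scalar_mx.
  by rewrite trmx_mul IH Ssym; congr (_ + _); apply/esym/comm_horner_mx.
apply/eqP; by rewrite -subr_eq0 -rS /r rmorphB !rmorphM /= horner_mx_X.
Qed.

(** This is why a fourth root [Y] is taken: the square root [Y *m Y] is then of the form $Y Y^T$
    with $Y$ invertible, hence positive definite. *)
Lemma posdef_sqrt n (S : 'M[R]_n) :
  posdef S -> exists X, posdef X /\ X *m X = S.
Proof.
move=> Spd; have [Y [Ysym YS]] := posdef_root4 Spd.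
exists (Y *m Y); split; last by rewrite mulmxA.
rewrite -{2}Ysym; apply: posdef_mxsquare; rewrite row_free_unit.
by move: (posdef_unit Spd); rewrite -YS unitmx_mul => /andP[].
Qed.

(** The Frobenius norm dominates the operator norm, by Cauchy-Schwarz on each column of [Q]. *)
Lemma dot_rV_mul_le n p (u : 'rV[R]_n) (Q : 'M[R]_(n, p)) :
  (u *m Q *m (u *m Q)^T) 0 0 <=
    (\sum_j \sum_i Q i j ^+ 2) * (u *m u^T) 0 0.
Proof.
rewrite !dot_rV mulr_suml; apply: ler_sum => j _; rewrite mxE.
(* Lagrange's identity, in the form of a sum of squares *)
rewrite -subr_ge0 -(pmulr_rge0 _ (@ltr0Sn R 1)).
(* The factor 2 lets the sum of squares run over all ordered pairs of indices. *)
suff -> : 2 * ((\sum_i Q i j ^+ 2) * (\sum_i u 0 i ^+ 2) -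
    (\sum_i u 0 i * Q i j) ^+ 2) =
    \sum_a \sum_b (Q a j * u 0 b - Q b j * u 0 a) ^+ 2.
  by apply: sumr_ge0 => a _; apply: sumr_ge0 => b _; exact: sqr_ge0.
have -> : \sum_a \sum_b (Q a j * u 0 b - Q b j * u 0 a) ^+ 2 =
    \sum_a \sum_b Q a j ^+ 2 * u 0 b ^+ 2 +
    \sum_a \sum_b Q b j ^+ 2 * u 0 a ^+ 2 -
    2 * \sum_a \sum_b (u 0 a * Q a j) * (u 0 b * Q b j).
  rewrite mulr_sumr -big_split -sumrB /=; apply: eq_bigr => a _.
  rewrite mulr_sumr -big_split -sumrB /=; apply: eq_bigr => b _; ring.
rewrite [X in _ + X - _]exchange_big /= expr2 !big_distrlr /=; ring.
Qed.

(** With $Z = X^{1/2}$ the quadratic form is $|wZ|^2$, and $w = (wZ)Z^{-1}$ is bounded by the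
    Frobenius norm of $Z^{-1}$. No compactness argument is involved. *)
Lemma posdef_coercive n (X : 'M[R]_n) : posdef X ->
  exists2 c, 0 < c &
    forall w : 'rV_n, c * (w *m w^T) 0 0 <= (w *m X *m w^T) 0 0.
Proof.
move=> Xpd; have [Z [Zpd ZX]] := posdef_sqrt Xpd.
have Zunit := posdef_unit Zpd.
(* The summand 1 makes [K] positive in every size, including 0. *)
pose K := 1 + \sum_j \sum_i invmx Z i j ^+ 2.
have K0 : 0 < K.
  rewrite ltr_pwDl // sumr_ge0 // => j _.
  by rewrite sumr_ge0 // => i _; exact: sqr_ge0.
exists K^-1 => [|w]; first by rewrite invr_gt0.
have := dot_rV_mul_le (w *m Z) (invmx Z); rewrite mulmxK // => wle.
have -> : w *m X *m w^T = w *m Z *m (w *m Z)^T.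
  by rewrite trmx_mul (proj1 Zpd) -ZX !mulmxA.
rewrite ler_pdivrMl //; apply: le_trans wle _.
by rewrite ler_wpM2r ?dot_rV_ge0 // ler_wpDl.
Qed.

(** * The Sylvester equation $YD + DX = E$ and uniqueness of square roots *)

Lemma mxtrace_gram n p (B : 'M[R]_(p, n)) (Y : 'M[R]_n) :
  \tr (B *m Y *m B^T) = \sum_i (row i B *m Y *m (row i B)^T) 0 0.
Proof.
apply: eq_bigr => i _; rewrite -row_mul [LHS]mxE [RHS]mxE.
by apply: eq_bigr => k _; rewrite !mxE.
Qed.

(** Pairing $E = YD + DX$ with $D$ in the Frobenius inner product gives $c|D|^2 \le
    \operatorname{tr}(D^T E) \le |D| \sum |E_{ab}|$, where $c$ is the coercivity constant of $X$.
    The constant [C] is thus uniform in [Y], which later varies around [X]. *)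
Lemma sylvester_bound n (X : 'M[R]_n) : posdef X ->
  exists C, forall Y D : 'M[R]_n, posdef Y -> forall i j,
    `|D i j| <= C * \sum_a \sum_b `|(Y *m D + D *m X) a b|.
Proof.
move=> /posdef_coercive[c c0 cX]; exists c^-1 => Y D Ypd i j.
set E := Y *m D + D *m X; pose e := \sum_a \sum_b `|E a b|.
rewrite -/e ler_pdivlMl //.
pose m := \sum_a \sum_b D a b ^+ 2.
have entry_le_sum (f : 'I_n -> 'I_n -> R) a b :
    (forall a b, 0 <= f a b) -> f a b <= \sum_a \sum_b f a b.
  move=> f0; rewrite (bigD1 a) //= (bigD1 b) //= -addrA lerDl.
  by rewrite addr_ge0 // !sumr_ge0 // => k _; rewrite sumr_ge0.
(* tr (D^T Y D) >= 0 and tr (D X D^T) >= c |D|^2 *)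
have cm : c * m <= \tr (D^T *m E).
  have := mxtrace_gram D^T Y; rewrite trmxK => trY.
  rewrite mulmxDr linearD /= mulmxA trY.
  rewrite mxtrace_mulC mxtrace_gram ler_wpDl //.
    by apply: sumr_ge0 => a _; exact: posdef_ge0.
  rewrite mulr_sumr; apply: ler_sum => a _; apply: le_trans (cX _).
  by rewrite dot_rV; under [in leRHS]eq_bigr do rewrite mxE.
have m0 : 0 <= m.
  by apply: sumr_ge0 => a _; apply: sumr_ge0 => b _; exact: sqr_ge0.
have D_le a b : `|D a b| <= Num.sqrt m.
  rewrite -sqrtr_sqr ler_wsqrtr //.
  by apply: (entry_le_sum (fun a b => D a b ^+ 2)) => *; exact: sqr_ge0.
have trE : \tr (D^T *m E) <= Num.sqrt m * e.
  have -> : \tr (D^T *m E) = \sum_a \sum_b D a b * E a b.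
    rewrite exchange_big /mxtrace; apply: eq_bigr => b _; rewrite mxE.
    by apply: eq_bigr => a _; rewrite mxE.
  rewrite mulr_sumr; apply: ler_sum => a _.
  rewrite mulr_sumr; apply: ler_sum => b _.
  by rewrite (le_trans (ler_norm _)) // normrM ler_wpM2r.
have e0 : 0 <= e by apply: sumr_ge0 => a _; apply: sumr_ge0.
(* The norm of [D] is to be cancelled from both sides, so the case [D = 0] is separate. *)
have [s0|s0] := leP (Num.sqrt m) 0.
  by rewrite (le_trans _ e0) // pmulr_rle0 // (le_trans (D_le _ _)).
rewrite (le_trans (ler_wpM2l (ltW c0) (D_le i j))) //.
rewrite -(ler_pM2l s0) mulrCA -expr2 sqr_sqrtr //.
exact: le_trans trE.
Qed.

Lemma sylvester_inj n (X Y D : 'M[R]_n) : posdef X -> posdef Y ->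
  Y *m D + D *m X = 0 -> D = 0.
Proof.
move=> Xpd Ypd E0; have [C CP] := sylvester_bound Xpd.
apply/matrixP => i j; rewrite [RHS]mxE; apply/eqP; rewrite -normr_le0.
rewrite (le_trans (CP Y D Ypd i j)) // E0 big1 ?mulr0 // => a _.
by rewrite big1 // => b _; rewrite mxE normr0.
Qed.

(** The difference $D = X - Y$ solves $YD + DX = X^2 - Y^2 = 0$. *)
Lemma posdef_sqrt_uniq n (X Y : 'M[R]_n) :
  posdef X -> posdef Y -> X *m X = Y *m Y -> X = Y.
Proof.
move=> Xpd Ypd XY; apply/eqP; rewrite -subr_eq0; apply/eqP.
apply: (sylvester_inj Xpd Ypd).
by rewrite mulmxBl mulmxBr XY addrC subrKA subrr.
Qed.

Lemma posdef_congr m n (B : 'M[R]_(m, n)) (S : 'M[R]_n) :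
  row_free B -> posdef S -> posdef (B *m S *m B^T).
Proof.
move=> Bfree [Ssym Spos]; split.
  by rewrite !trmx_mul trmxK Ssym mulmxA.
move=> v v0; have := Spos (v *m B); rewrite mulmx_free_eq0 // => /(_ v0).
by rewrite trmx_mul !mulmxA.
Qed.

(** The root is picked by choice, with [0] as default where there is none; [posdef_sqrt_uniq] shows
    that there is at most one candidate. *)
Definition sqrtmx n (S : 'M[R]_n) : 'M[R]_n :=
  xget 0 [set X | posdef X /\ X *m X = S].

Lemma sqrtmxP n (S : 'M[R]_n) :
  posdef S -> posdef (sqrtmx S) /\ sqrtmx S *m sqrtmx S = S.
Proof.
by move=> /posdef_sqrt XP; exact: (xgetPex 0 XP).
Qed.

Lemma posdef_sqrtmx n (S : 'M[R]_n) : posdef S -> posdef (sqrtmx S).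
Proof. by case/sqrtmxP. Qed.

Lemma mul_sqrtmx n (S : 'M[R]_n) : posdef S -> sqrtmx S *m sqrtmx S = S.
Proof. by case/sqrtmxP. Qed.

(** Both sides are positive definite with the same square, so uniqueness applies. *)
Lemma sqrtmx_conj n (P S : 'M[R]_n) : P *m P^T = 1%:M -> posdef S ->
  sqrtmx (P^T *m S *m P) = P^T *m sqrtmx S *m P.
Proof.
move=> PP Spd; have [Punit _] := mulmx1_unit PP.
have PTfree : row_free P^T by rewrite row_free_unit unitmx_tr.
have conj_posdef Q : posdef Q -> posdef (P^T *m Q *m P).
  by move=> /(posdef_congr PTfree); rewrite trmxK.
apply: posdef_sqrt_uniq.
- exact/posdef_sqrtmx/conj_posdef.
- exact/conj_posdef/posdef_sqrtmx.
- rewrite mul_sqrtmx; last exact: conj_posdef.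
  rewrite -!mulmxA [P *m (P^T *m _)]mulmxA PP mul1mx.
  by rewrite [sqrtmx S *m (sqrtmx S *m _)]mulmxA mul_sqrtmx.
Qed.

(* The rows of [F] are the vectors of a frame and [G] is the Gram matrix of the
   inner product; the rows of [parsevalize F G] form the canonical Parseval
   frame [S^(-1/2) F], [S] being the frame operator. *)
Definition parsevalize n k (F : 'M[R]_(n, k)) (G : 'M[R]_k) :=
  let H := sqrtmx G in
  F *m H *m invmx (sqrtmx ((F *m H)^T *m (F *m H))) *m invmx H.

(** When $H = G^{1/2}$, the rows of $FH$ are the frame vectors in orthonormal coordinates, and this
    matrix is that of the frame operator in them. *)
Lemma posdef_frame_gram n k (F : 'M[R]_(n, k)) (H : 'M[R]_k) :
  row_full F -> H \in unitmx -> posdef ((F *m H)^T *m (F *m H)).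
Proof.
move=> Ffull Hunit; rewrite -{2}[F *m H]trmxK; apply: posdef_mxsquare.
by rewrite /row_free mxrank_tr mxrankMfree // row_free_unit.
Qed.

(** This is the Parseval condition $AA^T = 1$ in coordinates, where the adjoint is right
    multiplication by $G N^T$. With $W = (FH)^T FH$ and $Q = W^{1/2}$ the product collapses to $H
    Q^{-1} W Q^{-1} H^{-1} = 1$. *)
Lemma parsevalizeP n k (F : 'M[R]_(n, k)) (G : 'M[R]_k) :
  row_full F -> posdef G ->
  G *m (parsevalize F G)^T *m parsevalize F G = 1%:M.
Proof.
move=> Ffull Gpd; rewrite /parsevalize.
have [[Hsym _] HG] := sqrtmxP Gpd.
have Hunit := posdef_unit (posdef_sqrtmx Gpd).
move: (sqrtmx G) => H in Hsym HG Hunit *.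
have Wpd := posdef_frame_gram Ffull Hunit.
have := sqrtmxP Wpd; have := posdef_unit (posdef_sqrtmx Wpd).
move: (sqrtmx _) => Q Qunit [[Qsym _] QW].
rewrite -HG [(_ *m invmx H)^T]trmx_mul trmx_inv Hsym !mulmxA mulmxK //.
rewrite [(_ *m invmx Q)^T]trmx_mul trmx_inv Qsym -!mulmxA.
rewrite [F *m (H *m _)]mulmxA [(F *m H)^T *m _]mulmxA -QW.
by rewrite !mulmxA -[_ *m invmx Q *m Q]mulmxA mulVmx // mulmx1 mulmxK // mulmxV.
Qed.

(** The canonical Parseval frame does not depend on the basis. The two choices of $G^{1/2}$ differ
    by an orthogonal matrix, which passes through the inner square root by [sqrtmx_conj]. *)
Lemma parsevalize_change_basis n k (F : 'M[R]_(n, k)) (G T : 'M[R]_k) :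
  row_full F -> T \in unitmx -> posdef G ->
  parsevalize (F *m T) G *m invmx T = parsevalize F (T *m G *m T^T).
Proof.
move=> Ffull Tunit Gpd; rewrite /parsevalize.
have Tfree : row_free T by rewrite row_free_unit.
have G'pd := posdef_congr Tfree Gpd.
have [[H'sym _] H'G] := sqrtmxP G'pd.
have H'unit := posdef_unit (posdef_sqrtmx G'pd).
have [[Hsym _] HG] := sqrtmxP Gpd.
have Hunit := posdef_unit (posdef_sqrtmx Gpd).
move: (sqrtmx G) (sqrtmx (T *m G *m T^T))
  => H K in Hsym HG Hunit H'sym H'G H'unit *.
(* $TH = KP$ is the polar decomposition: $K^2 = TGT^T = (TH)(TH)^T$ makes $P$ orthogonal. *)
pose P := invmx K *m T *m H.
have KP : K *m P = T *m H by rewrite /P !mulmxA mulmxV // mul1mx.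
have PP : P *m P^T = 1%:M.
  rewrite /P !trmx_mul trmx_inv H'sym Hsym -!mulmxA [H *m (H *m _)]mulmxA HG.
  rewrite [T *m _]mulmxA [T *m _ *m _]mulmxA -[T *m G *m T^T]H'G mulmxK //.
  exact: mulVmx.
have PH : P *m invmx H = invmx K *m T by rewrite mulmxK.
clearbody P.
have FP : F *m T *m H = F *m K *m P by rewrite -!mulmxA KP.
rewrite FP.
have -> : (F *m K *m P)^T *m (F *m K *m P) =
    P^T *m ((F *m K)^T *m (F *m K)) *m P.
  by rewrite [(_ *m P)^T]trmx_mul !mulmxA.
have Wpd := posdef_frame_gram Ffull H'unit.
rewrite sqrtmx_conj //; have := posdef_unit (posdef_sqrtmx Wpd).
move: (sqrtmx _) => Q Qunit.
have -> : invmx (P^T *m Q *m P) = P^T *m invmx Q *m P.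
  apply: mulmx1_invmx; rewrite -!mulmxA [P *m (P^T *m _)]mulmxA PP mul1mx.
  by rewrite [Q *m _]mulmxA mulmxV // mul1mx (mulmx1C PP).
rewrite -!mulmxA [P *m (P^T *m _)]mulmxA PP mul1mx; do 3 congr (_ *m _).
by rewrite mulmxA PH mulmxK.
Qed.

End PositiveDefinite.

(** * Functions of class C^r *)

Section CkCalculus.
Variables (R : realType) (d : nat) (U : set 'rV[R]_d).
Hypothesis Uopen : open U.
Implicit Types f g : 'rV[R]_d -> R.

(** The partial derivatives are identified with [df] on [U] only, hence the quantification over
    every [g] that agrees with [df i] there. *)
Lemma Ck_on_intro r f (df : 'I_d -> 'rV[R]_d -> R) :
  (forall x, U x -> {for x, continuous f}) ->
  (forall i x, U x -> is_derive x (delta_mx 0 i) f (df i x)) ->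
  (forall i g, (forall x, U x -> g x = df i x) -> Ck_on r U g) ->
  Ck_on r.+1 U f.
Proof.
move=> fc fd dfC; split=> // i; split=> [x Ux|]; first by case: (fd i x Ux).
by apply: (dfC i) => x Ux; case: (fd i x Ux).
Qed.

Lemma near_eq_on f g x : {in U, f =1 g} -> U x -> {near x, f =1 g}.
Proof.
move=> fg Ux; apply: filterS (open_nbhs_nbhs (conj Uopen Ux)) => y Uy.
exact/fg/mem_set.
Qed.

Lemma continuous_eq_on f g : {in U, f =1 g} ->
  (forall x, U x -> {for x, continuous f}) ->
  forall x, U x -> {for x, continuous g}.
Proof.
move=> fg fc x Ux; rewrite /prop_for /continuous_at.
have := fc x Ux; rewrite /prop_for /continuous_at (fg x (mem_set Ux)).
exact: cvg_trans (near_eq_cvg (near_eq_on fg Ux)).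
Qed.

(** As [U] is open, equality on [U] holds near each of its points and passes to derivatives. *)
Lemma Ck_on_eq r f g : {in U, f =1 g} -> Ck_on r U f -> Ck_on r U g.
Proof.
elim: r f g => [|r IH] f g fg.
  by move=> [/(continuous_eq_on fg)].
move=> [/(continuous_eq_on fg) gc fd]; split=> // i; have [fdi fC] := fd i.
split=> [x Ux|]; first exact: near_eq_derivable (near_eq_on fg Ux) (fdi x Ux).
apply: IH fC => x /set_mem Ux.
exact/near_eq_derive/near_eq_on.
Qed.

Lemma Ck_onW r f : Ck_on r.+1 U f -> Ck_on r U f.
Proof.
elim: r f => [|r IH] f [fc fd]; split=> // i.
by have [fdi fC] := fd i; split=> //; apply: IH.
Qed.

Lemma Ck_on_cst r (c : R) : Ck_on r U (fun=> c).
Proof.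
elim: r c => [|r IH] c; first by split=> // x _; exact: cst_continuous.
apply: (Ck_on_intro (df := fun _ _ => 0)) => [x _|i g g0].
- exact: cst_continuous.
- by apply: Ck_on_eq (IH 0) => x /set_mem/g0.
Qed.

Lemma Ck_onD r f g :
  Ck_on r U f -> Ck_on r U g -> Ck_on r U (fun x => f x + g x).
Proof.
elim: r f g => [|r IH] f g [fc fd] [gc gd].
  by split=> // x Ux; exact: cvgD (fc x Ux) (gc x Ux).
pose df (h : 'rV[R]_d -> R) i := 'D_(delta_mx 0 i) h.
apply: (Ck_on_intro (df := fun i x => df f i x + df g i x))
    => [x Ux|i x Ux|i h hE].
- by exact: cvgD (fc x Ux) (gc x Ux).
- by apply: is_deriveD; apply: derivableP; [apply: (fd i).1|apply: (gd i).1].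
- apply: (@Ck_on_eq _ (fun x => df f i x + df g i x)) => [x /set_mem/hE //|].
  by apply: IH; [exact: (fd i).2|exact: (gd i).2].
Qed.

Lemma Ck_onM r f g :
  Ck_on r U f -> Ck_on r U g -> Ck_on r U (fun x => f x * g x).
Proof.
elim: r f g => [|r IH] f g fC gC; have [fc fd] := fC; have [gc gd] := gC.
  by split=> // x Ux; exact: cvgM (fc x Ux) (gc x Ux).
pose df (h : 'rV[R]_d -> R) i := 'D_(delta_mx 0 i) h.
apply: (Ck_on_intro (df := fun i x => f x * df g i x + g x * df f i x))
    => [x Ux|i x Ux|i h hE].
- by exact: cvgM (fc x Ux) (gc x Ux).
- by apply: is_deriveM; apply: derivableP; [apply: (fd i).1|apply: (gd i).1].
- apply: (@Ck_on_eq _ (fun x => f x * df g i x + g x * df f i x))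
    => [x /set_mem/hE //|].
  apply: Ck_onD; apply: IH; [exact: Ck_onW|exact: (gd i).2|exact: Ck_onW|].
  exact: (fd i).2.
Qed.

(** The derivative $-f^{-2} \partial_i f$ involves only $f^{-1}$, of class $C^r$ by induction, and
    $\partial_i f$. *)
Lemma Ck_onV r f : (forall x, U x -> f x != 0) ->
  Ck_on r U f -> Ck_on r U (fun x => (f x)^-1).
Proof.
move=> f0; elim: r => [|r IH] fC; have [fc fd] := fC.
  by split=> // x Ux; exact: cvgV (f0 x Ux) (fc x Ux).
pose df i := 'D_(delta_mx 0 i) f.
pose dV i x := -1 * ((f x)^-1 * (f x)^-1) * df i x.
apply: (Ck_on_intro (df := dV)) => [x Ux|i x Ux|i h hE].
- by exact: cvgV (f0 x Ux) (fc x Ux).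
- have fdx : derivable f x (delta_mx 0 i) by apply: (fd i).1.
  apply: DeriveDef; first exact: derivableV (f0 x Ux) fdx.
  by rewrite (deriveV (f0 x Ux) fdx) /dV mulN1r -invfM -expr2.
- apply: (@Ck_on_eq _ (dV i)) => [x /set_mem/hE //|].
  have fVC := IH (Ck_onW fC).
  apply: Ck_onM; last exact: (fd i).2.
  by apply: Ck_onM; [exact: Ck_on_cst|exact: Ck_onM].
Qed.

Lemma Ck_on_sum r (I : Type) (s : seq I) (P : pred I) (F : I -> 'rV[R]_d -> R) :
  (forall i, P i -> Ck_on r U (F i)) ->
  Ck_on r U (fun x => \sum_(i <- s | P i) F i x).
Proof.
move=> FC; elim: s => [|i s IH].
  by apply: Ck_on_eq (Ck_on_cst r 0) => x _; rewrite big_nil.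
have [Pi|nPi] := boolP (P i); last first.
  by apply: Ck_on_eq IH => x _; rewrite big_cons (negbTE nPi).
by apply: Ck_on_eq (Ck_onD (FC i Pi) IH) => x _; rewrite big_cons Pi.
Qed.

Lemma Ck_on_prod r (I : Type) (s : seq I) (P : pred I)
    (F : I -> 'rV[R]_d -> R) :
  (forall i, P i -> Ck_on r U (F i)) ->
  Ck_on r U (fun x => \prod_(i <- s | P i) F i x).
Proof.
move=> FC; elim: s => [|i s IH].
  by apply: Ck_on_eq (Ck_on_cst r 1) => x _; rewrite big_nil.
have [Pi|nPi] := boolP (P i); last first.
  by apply: Ck_on_eq IH => x _; rewrite big_cons (negbTE nPi).
by apply: Ck_on_eq (Ck_onM (FC i Pi) IH) => x _; rewrite big_cons Pi.
Qed.

(** * Matrix-valued functions of class $C^r$ *)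

Definition mxCk_on r m n (A : 'rV[R]_d -> 'M[R]_(m, n)) : Prop :=
  forall i j, Ck_on r U (fun x => A x i j).

Lemma mxCk_on_mul r m n p (A : 'rV[R]_d -> 'M[R]_(m, n))
    (B : 'rV[R]_d -> 'M[R]_(n, p)) :
  mxCk_on r A -> mxCk_on r B -> mxCk_on r (fun x => A x *m B x).
Proof.
move=> AC BC i j.
apply: (@Ck_on_eq _ (fun x => \sum_k A x i k * B x k j)).
  by move=> x _; rewrite mxE.
by apply: Ck_on_sum => k _; exact: Ck_onM.
Qed.

Lemma mxCk_on_tr r m n (A : 'rV[R]_d -> 'M[R]_(m, n)) :
  mxCk_on r A -> mxCk_on r (fun x => (A x)^T).
Proof. by move=> AC i j; apply: Ck_on_eq (AC j i) => x _; rewrite mxE. Qed.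

Lemma Ck_on_det r n (A : 'rV[R]_d -> 'M[R]_n) :
  mxCk_on r A -> Ck_on r U (fun x => \det (A x)).
Proof.
move=> AC; apply: Ck_on_sum => s _; apply: Ck_onM; first exact: Ck_on_cst.
by apply: Ck_on_prod => i _; exact: AC.
Qed.

Lemma mxCk_on_inv r n (A : 'rV[R]_d -> 'M[R]_n) :
  (forall x, U x -> A x \in unitmx) ->
  mxCk_on r A -> mxCk_on r (fun x => invmx (A x)).
Proof.
move=> Aunit AC i j.
apply: (@Ck_on_eq _ (fun x => (\det (A x))^-1 * cofactor (A x) j i)).
  by move=> x /set_mem Ux; rewrite /invmx Aunit // !mxE.
apply: Ck_onM.
  by apply: Ck_onV (Ck_on_det AC) => x /Aunit; rewrite unitmxE unitfE.
apply: Ck_onM; first exact: Ck_on_cst.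
apply: Ck_on_det => a b.
by apply: Ck_on_eq (AC (lift j a) (lift i b)) => x _; rewrite !mxE.
Qed.

End CkCalculus.

(** * Smoothness of the square root *)

Lemma cvg_sumr (R : realType) (T I : Type) (F : set_system T) {FF : Filter F}
    (s : seq I) (f : I -> T -> R) (l : I -> R) :
  (forall i, f i t @[t --> F] --> l i) ->
  \sum_(i <- s) f i t @[t --> F] --> \sum_(i <- s) l i.
Proof.
by move=> fl; apply: cvg_big => [|i _]; [exact: add_continuous|exact: fl].
Qed.

(** The form in which [sylvester_bound] yields limits: a residual [E] that tends to 0 forces the
    unknown to converge. *)
Lemma cvg_dominated (R : realType) (T : Type) (F : set_system T) {FF : Filter F}
    n (u : T -> R) (E : T -> 'M[R]_n) (l C : R) :
  (forall a b, E t a b @[t --> F] --> 0) ->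
  (\forall t \near F, `|u t - l| <= C * \sum_a \sum_b `|E t a b|) ->
  u t @[t --> F] --> l.
Proof.
move=> E0 ule; apply/subr_cvg0/norm_cvg0P.
have : C * \sum_a \sum_b `|E t a b| @[t --> F] -->
    C * \sum_(a < n) \sum_(b < n) `|0 : R|.
    apply: cvgMl_tmp; apply: cvg_sumr => a; apply: cvg_sumr => b.
  exact: cvg_norm (E0 a b).
rewrite [X in C * X]big1 ?mulr0 => [sum0|a _]; last first.
  by rewrite big1 // => b _; rewrite normr0.
apply: (squeeze_cvgr _ (cvg_cst 0) sum0).
by apply: filterS ule => t ->; rewrite normr_ge0.
Qed.

Lemma cvg_line (R : realType) d (x v : 'rV[R]_d) :
  h *: v + x @[h --> 0^'] --> x.
Proof.
have : {for (0 : R), continuous (fun h : R => h *: v + x)}.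
  by apply: cvgD; [apply: cvgZr_tmp; exact: cvg_id|exact: cvg_cst].
by move=> /continuous_withinNx; rewrite scale0r add0r.
Qed.

(** * The Sylvester operator as an invertible matrix *)

Section SylvesterMatrix.
Variables (R : rcfType) (k : nat).
Implicit Types X D : 'M[R]_k.

(** Acting on vectorized matrices turns solving the equation into a matrix inversion, whose
    regularity is given by [mxCk_on_inv]. *)
Definition sylvester_mx X : 'M[R]_(k * k) := lin_mulmx X + lin_mulmxr X.

Lemma mul_sylvester_mx X D :
  mxvec D *m sylvester_mx X = mxvec (X *m D + D *m X).
Proof. by rewrite mulmxDr !mul_vec_lin /= linearD. Qed.

Lemma sylvester_mx_unit X : posdef X -> sylvester_mx X \in unitmx.
Proof.
move=> Xpd; rewrite unitmxE unitfE; apply/det0P => -[v v0 vL].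
move: v0; rewrite -[v]vec_mxK mxvec_eq0 => /eqP; apply.
apply: (sylvester_inj Xpd Xpd); apply: (can_inj mxvecK).
by rewrite -mul_sylvester_mx vec_mxK vL linear0.
Qed.

Definition sylvester_solve X (E : 'M[R]_k) : 'M[R]_k :=
  vec_mx (mxvec E *m invmx (sylvester_mx X)).

Lemma sylvester_solveP X E : posdef X ->
  X *m sylvester_solve X E + sylvester_solve X E *m X = E.
Proof.
move=> Xpd; apply: (can_inj mxvecK); rewrite -mul_sylvester_mx vec_mxK.
by rewrite mulmxKV // sylvester_mx_unit.
Qed.

End SylvesterMatrix.

Section SmoothSqrt.
Variables (R : realType) (d : nat) (U : set 'rV[R]_d).
Hypothesis Uopen : open U.

Lemma mxCk_on_sylvester_mx r k (X : 'rV[R]_d -> 'M[R]_k) :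
  mxCk_on U r X -> mxCk_on U r (fun x => sylvester_mx (X x)).
Proof.
move=> XC p q; case/mxvec_indexP: q => a b; case/mxvec_indexP: p => i j.
(* The row of index $(i, j)$ is the vectorized image of this elementary matrix, so its entries are
   linear in [X x]. *)
pose D : 'M[R]_k := delta_mx i j.
apply: (@Ck_on_eq _ _ _ Uopen _ (fun x => (X x *m D + D *m X x) a b)) => [x _|].
  by rewrite -[in LHS]mxvecE -mul_sylvester_mx mxvec_delta -rowE mxE.
have DC : mxCk_on U r (fun=> D) by move=> *; exact: Ck_on_cst.
apply: (@Ck_on_eq _ _ _ Uopen _ (fun x => (X x *m D) a b + (D *m X x) a b)).
  by move=> x _; rewrite [RHS]mxE.
by apply: Ck_onD => //; exact: mxCk_on_mul.
Qed.

Lemma mxCk_on_sylvester_solve r k (X E : 'rV[R]_d -> 'M[R]_k) :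
  (forall x, U x -> posdef (X x)) -> mxCk_on U r X -> mxCk_on U r E ->
  mxCk_on U r (fun x => sylvester_solve (X x) (E x)).
Proof.
move=> Xpd XC EC a b.
have LC : mxCk_on U r (fun x => invmx (sylvester_mx (X x))).
  apply: (mxCk_on_inv Uopen) => [x /Xpd/sylvester_mx_unit //|].
  exact: mxCk_on_sylvester_mx.
have EvC : mxCk_on U r (fun x => mxvec (E x)).
  move=> i j; case/mxvec_indexP: j => i' j'; rewrite ord1.
  by apply: (Ck_on_eq Uopen) (EC i' j') => x _; rewrite mxvecE.
have := mxCk_on_mul Uopen EvC LC 0 (mxvec_index a b).
by apply: (Ck_on_eq Uopen) => x _; rewrite [RHS]mxE.
Qed.

Variables (k : nat) (S : 'rV[R]_d -> 'M[R]_k).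
Hypothesis Spd : forall x, U x -> posdef (S x).
Let X x := sqrtmx (S x).

Let Xpd x : U x -> posdef (X x). Proof. by move=> /Spd/posdef_sqrtmx. Qed.

(** With [X y] on the left and [X x] on the right, the cross terms cancel without any
    commutation. *)
Lemma sqrtmx_diff x y : U x -> U y ->
  X y *m (X y - X x) + (X y - X x) *m X x = S y - S x.
Proof.
move=> Ux Uy; rewrite mulmxBr mulmxBl addrA subrK.
by rewrite !mul_sqrtmx //; exact: Spd.
Qed.

Lemma sqrtmx_continuous : (forall x, U x -> forall a b,
    {for x, continuous (fun y => S y a b)}) ->
  forall x, U x -> forall a b, {for x, continuous (fun y => X y a b)}.
Proof.
move=> Sc x Ux i j; have [C CP] := sylvester_bound (Xpd Ux).
apply: (@cvg_dominated _ _ _ (nbhs_filter x) _ _ (fun y => S y - S x) _ C)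
    => [a b|].
  have /subr_cvg0 := Sc x Ux a b; apply: cvg_trans; apply: near_eq_cvg.
  by apply: nearW => y; rewrite !mxE.
apply: filterS (open_nbhs_nbhs (conj Uopen Ux)) => y Uy.
by have := CP _ (X y - X x) (Xpd Uy) i j; rewrite sqrtmx_diff // !mxE.
Qed.

(** Differentiating $X^2 = S$ formally suggests the solution [Z] of $XZ + ZX = dS$. The error
    between the difference quotient and [Z] solves a Sylvester equation whose right-hand side tends
    to 0, by continuity of [X]. *)
Lemma sqrtmx_derive x (v : 'rV[R]_d) : U x ->
  (forall y, U y -> forall a b, {for y, continuous (fun z => S z a b)}) ->
  (forall a b, derivable (fun y => S y a b) x v) ->
  forall i j, is_derive x v (fun y => X y i j)
    (sylvester_solve (X x) (\matrix_(a, b) 'D_v (fun y => S y a b) x) i j).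
Proof.
move=> Ux Sc Sd i j; set dS := \matrix_(a, b) _; set Z := sylvester_solve _ _.
have ZE : X x *m Z + Z *m X x = dS by apply: sylvester_solveP; exact: Xpd.
suff XZ : h^-1 *: (X (h *: v + x) i j - X x i j) @[h --> 0^'] --> Z i j.
  by apply: DeriveDef; [apply/cvg_ex; exists (Z i j)|exact: cvg_lim XZ].
have [C CP] := sylvester_bound (Xpd Ux).
pose y h := h *: v + x.
(* Right-hand side of the equation with coefficients [X (y h)] and [X x] solved by the error. *)
pose E h := h^-1 *: (S (y h) - S x) - (X (y h) *m Z + Z *m X x).
apply: (@cvg_dominated _ _ _ _ _ _ E _ C) => [a b|].
  suff : E h a b @[h --> 0^'] -->
      dS a b - (\sum_c X x a c * Z c b + (Z *m X x) a b).
    rewrite [X in _ --> X](_ : _ = 0) // -ZE [X in X - _]mxE.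
    by rewrite [X in X + _ - _]mxE subrr.
  have -> : (fun h => E h a b) = fun h =>
      h^-1 *: (S (y h) a b - S x a b) -
      (\sum_c X (y h) a c * Z c b + (Z *m X x) a b).
    by apply/funext => h; rewrite !mxE.
  apply: cvgB; first by rewrite mxE; exact: Sd.
  apply: cvgD; last exact: cvg_cst.
  apply: cvg_sumr => c; apply: cvgMr_tmp.
  have Xc : {for x, continuous (fun z => X z a c)} by exact: sqrtmx_continuous.
  exact: (cvg_comp y (fun z => X z a c) (@cvg_line _ _ x v) Xc).
have Uy : \forall h \near 0^', U (y h).
  exact: (@cvg_line _ _ x v) (open_nbhs_nbhs (conj Uopen Ux)).
apply: filterS Uy => h Uyh.
have := CP _ (h^-1 *: (X (y h) - X x) - Z) (Xpd Uyh) i j.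
have -> : X (y h) *m (h^-1 *: (X (y h) - X x) - Z) +
    (h^-1 *: (X (y h) - X x) - Z) *m X x = E h.
  rewrite mulmxBr mulmxBl -scalemxAr -scalemxAl addrACA -opprD -scalerDr.
  by rewrite sqrtmx_diff.
by rewrite !mxE.
Qed.

(** The partial derivatives of [X] are functions of [X] and those of [S], all of class $C^r$ by
    induction, so [X] gains one order. *)
Lemma mxCk_on_sqrt r : mxCk_on U r S -> mxCk_on U r X.
Proof.
elim: r => [|r IH] SC.
  move=> i j; split=> // x Ux; apply: sqrtmx_continuous => // y Uy a b.
  exact: (SC a b).1.
have Sc y : U y -> forall a b, {for y, continuous (fun z => S z a b)}.
  by move=> Uy a b; exact: (SC a b).1.
have XC : mxCk_on U r X by apply: IH => i j; exact/Ck_onW/SC.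
pose dS l x := \matrix_(a, b) 'D_(delta_mx 0 l) (fun y => S y a b) x.
have dXC l : mxCk_on U r (fun x => sylvester_solve (X x) (dS l x)).
  apply: mxCk_on_sylvester_solve => // a b.
  by apply: (Ck_on_eq Uopen) ((SC a b).2 l).2 => x _; rewrite mxE.
move=> i j.
apply: (Ck_on_intro (df := fun l x => sylvester_solve (X x) (dS l x) i j)).
- by move=> x Ux; exact: sqrtmx_continuous.
- move=> l x Ux; apply: sqrtmx_derive => // a b; exact: ((SC a b).2 l).1.
- by move=> l h hE; apply: (Ck_on_eq Uopen) (dXC l i j) => x /set_mem/hE.
Qed.

End SmoothSqrt.

(** * Frames *)

Lemma mxCk_on_parsevalize (R : realType) d (U : set 'rV[R]_d) r n k
    (F : 'rV[R]_d -> 'M[R]_(n, k)) (G : 'rV[R]_d -> 'M[R]_k) : open U ->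
  (forall x, U x -> row_full (F x)) -> (forall x, U x -> posdef (G x)) ->
  mxCk_on U r F -> mxCk_on U r G ->
  mxCk_on U r (fun x => parsevalize (F x) (G x)).
Proof.
move=> Uopen Ffull Gpd FC GC.
have HC := mxCk_on_sqrt Uopen Gpd GC.
have Hunit x : U x -> sqrtmx (G x) \in unitmx.
  by move=> /Gpd/posdef_sqrtmx/posdef_unit.
have FHC := mxCk_on_mul Uopen FC HC.
have Wpd x : U x ->
    posdef ((F x *m sqrtmx (G x))^T *m (F x *m sqrtmx (G x))).
  by move=> Ux; apply: posdef_frame_gram; [exact: Ffull|exact: Hunit].
have WC := mxCk_on_mul Uopen (mxCk_on_tr Uopen FHC) FHC.
have QC := mxCk_on_sqrt Uopen Wpd WC.
apply: (mxCk_on_mul Uopen); last exact: mxCk_on_inv.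
apply: (mxCk_on_mul Uopen) => //; apply: mxCk_on_inv => // x Ux.
exact/posdef_unit/posdef_sqrtmx/Wpd.
Qed.

(** * A fiber in the coordinates of a trivialization *)

Section FiberCoordinates.
Variables (R : realType) (V : vectType R) (g : {dot V for idfun}) (k : nat).
Variable t : 'Hom(V, 'rV[R]_k).
Hypotheses (tker : lker t = 0%VS) (timg : limg t = fullv).

Lemma trivVK w : t ((t^-1)%VF w) = w.
Proof. by rewrite limg_lfunVK // timg memvf. Qed.

Lemma trivK v : (t^-1)%VF (t v) = v.
Proof. by rewrite lker0_lfunK // tker. Qed.

Lemma triv_expand v : v = \sum_a t v 0 a *: (t^-1)%VF (delta_mx 0 a).
Proof.
rewrite -{1}[v]trivK {1}[t v]row_sum_delta linear_sum.
by apply: eq_bigr => a _; rewrite linearZ.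
Qed.

Definition gram_mx : 'M[R]_k :=
  \matrix_(a, b) g ((t^-1)%VF (delta_mx 0 a)) ((t^-1)%VF (delta_mx 0 b)).

Lemma gram_mxE u v : g u v = (t u *m gram_mx *m (t v)^T) 0 0.
Proof.
rewrite {1}[u]triv_expand linear_sumlz -mulmxA mxE; apply: eq_bigr => a _.
rewrite linearZl_LR /= {1}[v]triv_expand linear_sum mxE; congr (_ * _).
by apply: eq_bigr => b _; rewrite linearZ /= !mxE mulrC.
Qed.

Lemma gram_mx_posdef : posdef gram_mx.
Proof.
split=> [|v v0].
  by apply/matrixP => a b; rewrite !mxE [LHS]hermC /= expr0 mul1r.
rewrite -[v]trivVK -gram_mxE; apply: neq0_dnorm_gt0.
by apply: contra_neq v0 => /(congr1 t); rewrite trivVK linear0.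
Qed.

(** Frame vectors are rows, so that [A] becomes right multiplication. *)
Definition frame_mx n (A : 'Hom('rV[R]_n, V)) : 'M[R]_(n, k) :=
  \matrix_(j, a) t (A (delta_mx 0 j)) 0 a.

Lemma frame_mxE n (A : 'Hom('rV[R]_n, V)) x : t (A x) = x *m frame_mx A.
Proof.
rewrite {1}[x]row_sum_delta !linear_sum mulmx_sum_row; apply: eq_bigr => j _.
by rewrite !linearZ /=; congr (_ *: _); apply/rowP => a; rewrite !mxE.
Qed.

Lemma frame_mx_full n (A : 'Hom('rV[R]_n, V)) :
  frames A -> row_full (frame_mx A).
Proof.
rewrite /frames /= => Aimg; rewrite -sub1mx; apply/row_subP => a.
have : (t^-1)%VF (row a 1%:M) \in limg A by rewrite Aimg memvf.
case/memv_imgP => x _ /(congr1 t); rewrite trivVK frame_mxE => ->.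
exact: submxMl.
Qed.

Definition frame_of_mx n (N : 'M[R]_(n, k)) : 'Hom('rV[R]_n, V) :=
  (t^-1 \o linfun (mulmxr N))%VF.

Lemma frame_of_mxE n (N : 'M[R]_(n, k)) x : t (frame_of_mx N x) = x *m N.
Proof. by rewrite comp_lfunE trivVK lfunE. Qed.

(** In coordinates the adjoint is right multiplication by $G N^T$, so $BB^T$ is right multiplication
    by $G N^T N$. *)
Lemma frame_of_mx_parseval n (N : 'M[R]_(n, k)) :
  gram_mx *m N^T *m N = 1%:M -> parseval_frames g (frame_of_mx N).
Proof.
move=> NN; set B := frame_of_mx N.
have BB v : B (adjoint g B v) = v.
  rewrite -[LHS]trivK -[RHS]trivK frame_of_mxE; congr (_ _).
  suff -> : adjoint g B v = t v *m gram_mx *m N^T.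
    by rewrite -!mulmxA [gram_mx *m _]mulmxA NN mulmx1.
  rewrite adjointE; apply/rowP => j; rewrite mxE.
  have [gsym _] := gram_mx_posdef.
  rewrite hermC /= expr0 mul1r gram_mxE frame_of_mxE.
  by rewrite trmx_mul trmx_delta mulmxA -colE [LHS]mxE.
split; last by apply/lfunP => v; rewrite comp_lfunE BB id_lfunE.
(* Surjectivity follows from the same identity: the adjoint provides preimages. *)
apply/vspaceP => v; rewrite memvf; apply/memv_imgP.
by exists (adjoint g B v); rewrite ?memvf ?BB.
Qed.

End FiberCoordinates.

(** * Independence of the trivialization *)

Section ChangeOfTrivialization.
Variables (R : realType) (V : vectType R) (g : {dot V for idfun}) (k : nat).
Variables s t : 'Hom(V, 'rV[R]_k).
Hypotheses (sker : lker s = 0%VS) (simg : limg s = fullv).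
Hypotheses (tker : lker t = 0%VS) (timg : limg t = fullv).

(** The transition matrix [T] gives $F_t = F_s T$ and $G_s = T G_t T^T$, the situation of
    [parsevalize_change_basis]. A frame built through [s] can therefore be read through [t] by the
    same formula. *)
Lemma parsevalize_triv n (A : 'Hom('rV[R]_n, V)) x : frames A ->
  t (frame_of_mx s (parsevalize (frame_mx s A) (gram_mx g s)) x) =
  x *m parsevalize (frame_mx t A) (gram_mx g t).
Proof.
move=> Aframe.
pose T : 'M[R]_k := \matrix_(a, b) t ((s^-1)%VF (delta_mx 0 a)) 0 b.
have TE v : t v = s v *m T.
  rewrite {1}(triv_expand sker v) linear_sum mulmx_sum_row.
  apply: eq_bigr => a _; rewrite linearZ /=; congr (_ *: _).
  by apply/rowP => b; rewrite !mxE.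
have Tunit : T \in unitmx.
  rewrite unitmxE unitfE; apply/det0P => -[w w0 wT]; case/eqP: w0.
  have := congr1 (t^-1)%VF (TE ((s^-1)%VF w)).
  rewrite (trivK tker) (trivVK simg) wT linear0 => sw0.
  by rewrite -[w](trivVK simg) sw0 linear0.
have -> : frame_mx t A = frame_mx s A *m T.
  apply/row_matrixP => j; rewrite row_mul !rowE -(frame_mxE s) -(frame_mxE t).
  exact: TE.
have GE : gram_mx g s = T *m gram_mx g t *m T^T.
  apply/matrixP => a b; rewrite mxE (gram_mxE g tker) !TE !(trivVK simg).
  by rewrite trmx_mul trmx_delta !mulmxA -colE -!mulmxA -rowE !mxE.
rewrite TE (frame_of_mxE simg) GE.
have sfull := frame_mx_full simg Aframe.
have tpd : posdef (gram_mx g t) by exact: gram_mx_posdef.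
by rewrite -parsevalize_change_basis // mulmxA mulmxKV.
Qed.

End ChangeOfTrivialization.

(** The inverse chart is continuous on the open image of the chart, so the preimage of [W] is a
    neighbourhood of each of its points there. The calculus of [Ck_on] needs this openness. *)
Lemma chart_image_open_sub (R : realType) (d : nat) (M : smooth_manifold R d)
    (c : chart_index M) (W : set M) :
  open W -> open (coord_map c @` (chart_dom c `&` W)).
Proof.
move=> Wopen; rewrite openE => x [p [dp Wp] <-{x}].
have imO := @chart_image_open _ _ M c.
have imp : (coord_map c @` chart_dom c) (coord_map c p) by exists p.
have invc : {for coord_map c p, continuous (chart_inv c)}.
  have := @chart_inv_continuous _ _ M c.
  rewrite continuous_open_subspace //; apply; exact: mem_set.
have Wnear : nbhs (chart_inv c (coord_map c p)) W.
  by rewrite coord_mapK //; exact: open_nbhs_nbhs.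
rewrite /interior; have nim := open_nbhs_nbhs (conj imO imp).
apply: filterS (filterI nim (invc _ Wnear)) => y [[q dq <-]].
by rewrite /preimage /= coord_mapK // => Wq; exists q.
Qed.

Theorem corollary3p8 (R : realType) (d k n : nat) (M : smooth_manifold R d)
    (E : vector_bundle M k) (g : riemannian_structure E)
    (hE : orientable E) (hkn : (k <= n)%N) :
  admits_parseval_frame g n <-> admits_frame E n.
Proof.
split=> [[A [Asm AP]]|[A [Asm Aframe]]].
  by exists A; split=> // p; case: (AP p).
(* [tr] chooses a trivialization at each point with no regularity in the point; [B] is smooth all
   the same because it does not depend on that choice. *)
have [tr tr_dom] := choice (@triv_cover _ _ _ _ E).
pose F i p := frame_mx (triv i p) (A p).
pose G i p := gram_mx (g p) (triv i p).
pose N i p := parsevalize (F i p) (G i p).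
pose B p := frame_of_mx (triv (tr p) p) (N (tr p) p).
have Gpd i p : triv_dom i p -> posdef (G i p).
  move=> ip; apply: gram_mx_posdef; first exact: triv_injective.
  exact: triv_surjective.
have Ffull i p : triv_dom i p -> row_full (F i p).
  by move=> ip; apply: frame_mx_full (Aframe p); exact: triv_surjective.
exists B; split=> [j i a c r|p]; last first.
  apply: frame_of_mx_parseval.
  - exact: triv_injective.
  - exact: triv_surjective.
  - by apply: parsevalizeP; [exact: Ffull|exact: Gpd].
rewrite setTI; set U := _ @` _.
have Uopen : open U by apply: chart_image_open_sub; exact: triv_dom_open.
have Udom x : U x -> triv_dom i (chart_inv c x).
  by move=> [p [cp ip] <-]; rewrite coord_mapK.
have FC : mxCk_on U r (fun x => F i (chart_inv c x)).
  move=> l b; have := Asm l i b c r; rewrite setTI.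
  by apply: (Ck_on_eq Uopen) => x _; rewrite mxE.
have GC : mxCk_on U r (fun x => G i (chart_inv c x)).
  move=> b e; have := @inner_smooth _ _ _ _ _ g i b e c r.
  by apply: (Ck_on_eq Uopen) => x _; rewrite mxE.
have NC : mxCk_on U r (fun x => N i (chart_inv c x)).
  by apply: mxCk_on_parsevalize => // x /Udom; [exact: Ffull|exact: Gpd].
(* Over the domain of the fixed trivialization [i], the coordinates of [B] are the entries of the
   smooth matrix [N i], whatever [tr] selects. *)
apply: (Ck_on_eq Uopen) (NC j a) => x /set_mem/Udom ix.
have tx := tr_dom (chart_inv c x).
rewrite /B (parsevalize_triv _ (triv_injective tx) (triv_surjective tx)
  (triv_injective ix) (triv_surjective ix)) //.
by rewrite -rowE [RHS]mxE.
Qed.
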